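(* Let $\alpha,\beta$ be arbitrary Hermitian metrics on a complex manifold $X$ with $\dim_{\mathbb{C}}X=n$. The following pointwise inequalities hold on $X$ for every $p\in\{1,\dots,n\}$ and for every smooth form $\Omega^{n-p,n-p}\geq 0$ of bidegree $(n-p,n-p)$ on $X$: $$\binom{n}{p}\,\frac{\alpha^{n-p}\wedge\beta^p}{\alpha^n}\cdot\frac{\alpha^p\wedge\Omega^{n-p,n-p}}{\alpha^n}\geq\frac{\beta^p\wedge\Omega^{n-p,n-p}}{\alpha^n}$$ and $$\frac{n}{p}\,\frac{\alpha^{n-1}\wedge\beta}{\alpha^n}\cdot\frac{\alpha^p\wedge\Omega^{n-p,n-p}}{\alpha^n}\geq\frac{\alpha^{p-1}\wedge\beta\wedge\Omega^{n-p,n-p}}{\alpha^n}.$$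
   Context: A Hermitian metric on $X$ is identified with its associated $C^\infty$ positive definite $(1,1)$-form. The quotient of a smooth $(n,n)$-form by $\alpha^n$ is the function $f$ such that the form equals $f\,\alpha^n$. Positivity of forms is weak positivity: a $C^\infty$ real $(q,q)$-form $\Omega^{q,q}$ is positive, written $\Omega^{q,q}\geq 0$, if for all $(1,0)$-forms $\alpha_1,\dots,\alpha_{n-q}$ the $(n,n)$-form $\Omega^{q,q}\wedge i\alpha_1\wedge\overline{\alpha}_1\wedge\dots\wedge i\alpha_{n-q}\wedge\overline{\alpha}_{n-q}$ is non-negative. *)

(* Defs.v *)
From HB Require Import structures.
From mathcomp Require Import all_boot all_order all_algebra.
From mathcomp Require Import complex.
From mathcomp Require Import all_classical all_reals all_analysis.

Set Implicit Arguments.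
Unset Strict Implicit.
Unset Printing Implicit Defensive.

Import Order.TTheory GRing.Theory Num.Theory.
Import numFieldNormedType.Exports.

Local Open Scope classical_set_scope.
Local Open Scope ring_scope.
Local Open Scope complex_scope.

(* Instances for an abstract numFieldType do not apply to the type R[i].      *)
HB.instance Definition _ (R : realType) := NormedModule.copy R[i] R[i]^o.

(* The exterior algebra of K^m, in coordinates: the value of a : ext K m at   *)
(* S = {i_1 < ... < i_k} is the coefficient of e_(i_1) /\ ... /\ e_(i_k).     *)
Definition ext (K : comNzRingType) (m : nat) : Type :=
  {ffun {set 'I_m} -> K^o}.
HB.instance Definition _ (K : comNzRingType) (m : nat) :=
  GRing.Lmodule.on (ext K m).

Section ExteriorAlgebra.
Variables (K : comNzRingType) (m : nat).

Definition ext_basis (S : {set 'I_m}) : ext K m := [ffun T => (T == S)%:R].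
Definition ext_one : ext K m := ext_basis finset.set0.
Definition ext_gen (i : 'I_m) : ext K m := ext_basis (finset.set1 i).

(* The number of transpositions that sort the elements of S followed by those *)
(* of T, for disjoint S and T.                                                *)
Definition inversions (S T : {set 'I_m}) : nat :=
  #|[set ij : 'I_m * 'I_m |
      [&& ij.1 \in S, ij.2 \in T & (ij.2 < ij.1)%N]]%SET|.

Definition wedge (a b : ext K m) : ext K m :=
  [ffun U : {set 'I_m} => \sum_(S : {set 'I_m} | S \subset U)
     (-1) ^+ inversions S (U :\: S)%SET * (a S * b (U :\: S)%SET)].

Definition wedge_exp (a : ext K m) (k : nat) : ext K m :=
  iter k (wedge a) ext_one.

End ExteriorAlgebra.

Arguments ext_one {K m}.
Arguments ext_gen {K m} i.

Declare Scope ext_scope.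
Delimit Scope ext_scope with ext.
Notation "a '\w' b" := (wedge a b)
  (at level 40, left associativity) : ext_scope.
Notation "a '^\w' k" := (wedge_exp a k%N)
  (at level 29, left associativity) : ext_scope.
Notation "\bigw_ ( i <- r ) F" := (\big[@wedge _ _/ext_one]_(i <- r) F)
  (at level 40, F at level 40, i, r at level 50,
   format "\bigw_ ( i  <-  r )  F") : ext_scope.
Local Open Scope ext_scope.

(* The s-semilinear multiplicative map ext K m1 -> ext K m2 sending the i-th  *)
(* generator to f i; enum S lists S increasingly.                             *)
Definition ext_lift (K : comNzRingType) (m1 m2 : nat) (s : K -> K)
    (f : 'I_m1 -> ext K m2) (a : ext K m1) : ext K m2 :=
  \sum_(S : {set 'I_m1}) s (a S) *: \bigw_(i <- enum S) f i.

(* Complex-valued exterior forms on C^n: the first n generators are           *)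
(* dz_1, ..., dz_n, the last n are their conjugates.                          *)
Section FormsAtAPoint.
Variables (R : realType) (n : nat).
Local Notation C := R[i].
Local Notation cform := (ext C (n + n)).

Definition dz (j : 'I_n) : cform := ext_gen (lshift n j).
Definition dzbar (j : 'I_n) : cform := ext_gen (rshift n j).

Definition has_bidegree (p q : nat) (a : cform) : Prop :=
  forall S : {set 'I_(n + n)}, a S != 0 ->
    #|[set j : 'I_n | lshift n j \in S]%SET| = p /\
    #|[set j : 'I_n | rshift n j \in S]%SET| = q.

Definition conj_form (a : cform) : cform :=
  ext_lift (fun c : C => c^*)
    (fun i : 'I_(n + n) =>
       match fintype.split i with inl j => dzbar j | inr j => dz j end) a.

(* Pullback along the C-linear map v |-> v *m A (the convention of jacobian). *)
Definition pullback_form (A : 'M[C]_n) (a : cform) : cform :=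
  ext_lift id
    (fun i : 'I_(n + n) => match fintype.split i with
              | inl j => \sum_(k < n) A k j *: dz k
              | inr j => \sum_(k < n) (A k j)^* *: dzbar k
              end) a.

Definition volume_form : cform :=
  \bigw_(j <- enum 'I_n) ('i *: (dz j \w dzbar j)).

Definition nonneg_top_form (a : cform) : Prop :=
  exists2 c : C, 0 <= c & a = c *: volume_form.

Definition weakly_positive (q : nat) (a : cform) : Prop :=
  forall f : 'I_(n - q) -> cform, (forall k, has_bidegree 1 0 (f k)) ->
    nonneg_top_form
      (a \w \bigw_(k <- enum 'I_(n - q)) ('i *: (f k \w conj_form (f k)))).

(* i \sum_(j, k) H_jk dz_j /\ dzbar_k with H Hermitian positive definite; on  *)
(* R[i], 0 < c means that c is real and positive.                             *)
Definition positive_definite11 (a : cform) : Prop :=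
  exists H : 'M[C]_n,
    [/\ forall j k, H k j = (H j k)^*,
        forall v : 'rV[C]_n, v != 0 ->
          0 < \sum_(j < n) \sum_(k < n) H j k * v 0 j * (v 0 k)^*
      & a = \sum_(j < n) \sum_(k < n) ('i * H j k) *: (dz j \w dzbar k)].

End FormsAtAPoint.

(* C^oo on the open set U: all iterated partial derivatives exist and are     *)
(* continuous on U.                                                           *)
Definition smooth_on (R : realType) (m : nat) (U : set 'rV[R]_m)
    (f : 'rV[R]_m -> R) : Prop :=
  forall (s : seq 'I_m) (x : 'rV[R]_m), U x ->
    let g := foldr (fun i h => 'D_(delta_mx 0 i) h) f s in
    {for x, continuous g} /\ forall i : 'I_m, derivable g x (delta_mx 0 i).

(* Differentiability in transition_holo is over the field R[i], i.e. complex  *)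
(* differentiability; since the overlap of two chart domains is open, this    *)
(* says that the transition maps are holomorphic.                             *)
Record complexManifold (R : realType) (n : nat) := ComplexManifold {
  carrier :> topologicalType ;
  hausdorff_carrier : hausdorff_space carrier ;
  countable_carrier : @second_countable carrier ;
  chart : Type ;
  chart_dom : chart -> set carrier ;
  chart_map : chart -> carrier -> 'rV[R[i]]_n ;
  chart_inv : chart -> 'rV[R[i]]_n -> carrier ;
  chart_dom_open : forall c, open (chart_dom c) ;
  chart_img_open : forall c, open (chart_map c @` chart_dom c) ;
  chart_mapK : forall c x, chart_dom c x -> chart_inv c (chart_map c x) = x ;
  chart_map_cont : forall c, {within chart_dom c, continuous (chart_map c)} ;
  chart_inv_cont : forall c,
    {within chart_map c @` chart_dom c, continuous (chart_inv c)} ;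
  chart_cover : forall x, exists c, chart_dom c x ;
  transition_holo : forall c d x, chart_dom c x -> chart_dom d x ->
    differentiable (chart_map d \o chart_inv c) (chart_map c x)
}.

Section FormsOnAManifold.
Variables (R : realType) (n : nat) (X : complexManifold R n).
Local Notation C := R[i].

(* A chosen chart around x, whose differential at x identifies the tangent    *)
(* space at x with C^n.                                                       *)
Definition chart_at (x : X) : chart X := projT1 (cid (chart_cover x)).

(* A differential form assigns to x an exterior form on the tangent space at  *)
(* x, read in the chart chart_at x.                                           *)
Definition diff_form : Type := X -> ext C (n + n).

(* The coefficients of w in the coordinates of the chart c, obtained by       *)
(* pulling w y back from the coordinates of chart_at y to those of c.         *)
Definition local_form (c : chart X) (w : diff_form) (z : 'rV[C]_n) :
    ext C (n + n) :=
  let y := chart_inv c z in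
  pullback_form (jacobian (chart_map (chart_at y) \o chart_inv c) z) (w y).

Definition complex_coord (u : 'rV[R]_(n + n)) : 'rV[C]_n :=
  \row_j (u 0 (lshift n j) +i* u 0 (rshift n j)).

Definition smooth_form (p q : nat) (w : diff_form) : Prop :=
  (forall x, has_bidegree p q (w x)) /\
  forall (c : chart X) (S : {set 'I_(n + n)}),
    let U := [set u | (chart_map c @` chart_dom c) (complex_coord u)] in
    smooth_on U (fun u => complex.Re (local_form c w (complex_coord u) S)) /\
    smooth_on U (fun u => complex.Im (local_form c w (complex_coord u) S)).

Definition hermitian_metric (w : diff_form) : Prop :=
  smooth_form 1 1 w /\ forall x, positive_definite11 (w x).

Definition real_form (w : diff_form) : Prop := forall x, conj_form (w x) = w x.

Definition positive_form (q : nat) (w : diff_form) : Prop :=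
  [/\ smooth_form q q w, real_form w & forall x, weakly_positive q (w x)].

Definition wedgef (v w : diff_form) : diff_form := fun x => v x \w w x.
Definition wedgef_exp (w : diff_form) (k : nat) : diff_form :=
  fun x => w x ^\w k.

(* The function f such that v = f w, where such an f exists.                  *)
Definition quotient_form (v w : diff_form) : X -> C :=
  fun x => xget 0 [set c : C | v x = c *: w x].

End FormsOnAManifold.

Declare Scope form_scope.
Delimit Scope form_scope with form.
Notation "v '\w' w" := (wedgef v w)
  (at level 40, left associativity) : form_scope.
Notation "w '^\w' k" := (wedgef_exp w k%N)
  (at level 29, left associativity) : form_scope.
Notation "v ÷ w" := (quotient_form v w)
  (at level 45, no associativity) : form_scope.

(* Main.v *)
Require Import Defs.
From mathcomp Require Import all_boot all_order all_algebra.
From mathcomp Require Import complex.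
From mathcomp Require Import all_classical all_reals all_analysis.
From HB Require Import structures.
From mathcomp Require Import fintype finset spectral sesquilinear ring.

Import Order.TTheory GRing.Theory Num.Theory.
Import numFieldNormedType.Exports.

Local Open Scope ring_scope.

Set Implicit Arguments.
Unset Strict Implicit.
Unset Printing Implicit Defensive.

(** Everything happens in the exterior algebra at one point.  Two positive
    definite Hermitian matrices are simultaneously diagonalizable by a
    congruence ([simultaneous_diag]), so there are a coframe theta_1, ...,
    theta_n of (1,0)-forms and numbers l_i > 0 such that, with
    w_i := i theta_i /\ conj theta_i,
      alpha = sum_i w_i      and      beta = sum_i l_i w_i
    ([common_coframe]).  The w_i are central and square to zero, so that powers
    of alpha and beta expand over the square-free monomials
    w_J := prod_(i in J) w_i:
      beta^k = k! sum_(|J| = k) l_J w_J,     l_J := prod_(i in J) l_i,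
    with l_J = 1 for alpha ([exp_mono_comb]).  Weak positivity of Omega
    implies that Omega /\ w_J is a nonnegative multiple c_J of the volume
    form when |J| = p ([weakly_positive_mono]), and w_1 ... w_n is a positive
    multiple of it, the factor being the squared modulus of the determinant of
    the coframe ([prod_coframe11]).  Up to positive factors, the two inequalities
    then read
      sum_J l_J c_J <= (sum_J l_J) (sum_J c_J),
      sum_J (sum_(i in J) l_i) c_J <= (sum_i l_i) (sum_J c_J),
    where J ranges over the sets of p indices; both hold because all l_i and
    c_J are nonnegative.

    To calculate with products of forms, the exterior algebra is first turned
    into an associative algebra. *)

(** * The exterior algebra as an associative algebra *)

Section ExteriorRing.
Variables (K : comNzRingType) (m : nat).
Implicit Types (a b c : ext K m) (S T U : {set 'I_m}).

Lemma inversionsUl S T U : [disjoint S & T] ->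
  inversions (S :|: T) U = (inversions S U + inversions T U)%N.
Proof.
move=> dST; rewrite /inversions -cardsUI.
rewrite [X in (_ + #|pred_of_set X|)%N](_ : _ = finset.set0) ?cards0 ?addn0.
  by apply: eq_card => -[i j]; rewrite !inE /= andb_orl.
apply/setP=> -[i j]; rewrite !inE /=; apply/negbTE/negP.
by case/andP=> /andP[iS _] /andP[iT _]; rewrite (disjointFr dST iS) in iT.
Qed.

Lemma inversionsUr S T U : [disjoint T & U] ->
  inversions S (T :|: U) = (inversions S T + inversions S U)%N.
Proof.
move=> dTU; rewrite /inversions -cardsUI.
rewrite [X in (_ + #|pred_of_set X|)%N](_ : _ = finset.set0) ?cards0 ?addn0.
  by apply: eq_card => -[i j]; rewrite !inE /= andb_orl andb_orr.
apply/setP=> -[i j]; rewrite !inE /=; apply/negbTE/negP.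
case/andP=> /and3P[_ iT _] /and3P[_ iU _].
by rewrite (disjointFr dTU iT) in iU.
Qed.

Lemma inversions0l T : inversions finset.set0 T = 0%N.
Proof. by apply/eqP; rewrite cards_eq0; apply/eqP/setP=> ij; rewrite !inE. Qed.

Lemma inversions0r S : inversions S finset.set0 = 0%N.
Proof.
by apply/eqP; rewrite cards_eq0; apply/eqP/setP=> ij; rewrite !inE andbF.
Qed.

(** Each pair in S * T is an inversion of exactly one of the two orders: this is
    the source of graded commutativity. *)
Lemma inversions_sym S T : [disjoint S & T] ->
  (inversions S T + inversions T S = #|S| * #|T|)%N.
Proof.
move=> dST; rewrite -cardsX /inversions.
rewrite -[in X in (_ + X)%N](card_imset _ (can_inj (@swap_pairK _ _))).
rewrite -cardsUI [X in (_ + #|pred_of_set X|)%N](_ : _ = finset.set0).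
  rewrite cards0 addn0; apply: eq_card => -[i j]; rewrite !inE /=.
  rewrite (_ : (_ \in _ @: _) = [&& j \in T, i \in S & (i < j)%N]); last first.
    apply/imsetP/idP => [[[k l] /=]|H].
      by rewrite !inE /= => H [-> ->].
    by exists (j, i); rewrite // inE.
  case iS: (i \in S) => //=; last by rewrite andbF.
  case jT: (j \in T) => //=.
  rewrite -neq_ltn; apply/eqP=> ij; move/ord_inj: ij jT => ->.
  by rewrite (disjointFr dST iS).
apply/setP=> -[i j]; rewrite !inE /=; apply/negbTE/negP.
case/andP=> /and3P[_ _ lt1] /imsetP[[k l]]; rewrite !inE /=.
case/and3P=> _ _ lt2 [ei ej]; move: lt1 lt2.
by rewrite ei ej ltnNge => /negP h /ltnW /h.
Qed.

(** Reduces multilinear identities to basis vectors. *)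
Lemma ext_decomp a : a = \sum_S a S *: ext_basis K S.
Proof.
apply/ffunP=> U; rewrite sum_ffunE (bigD1 U) //= !ffunE eqxx.
rewrite big1 ?addr0; first by rewrite [RHS]mulr1.
by move=> S nSU; rewrite !ffunE eq_sym (negPf nSU) [LHS]mulr0.
Qed.

Lemma wedge_basis S T : wedge (ext_basis K S) (ext_basis K T) =
  if [disjoint S & T] then (-1) ^+ inversions S T *: ext_basis K (S :|: T)
  else 0.
Proof.
apply/ffunP=> U; rewrite ffunE.
have [/andP[dST /eqP ->{U}]|nU] :=
  boolP ([disjoint S & T] && (U == S :|: T)).
  have TE : (S :|: T) :\: S = T.
    by rewrite setDUl setDv set0U; apply/setDidPl; rewrite disjoint_sym.
  rewrite dST !ffunE (bigD1 S) ?subsetUl //= !ffunE TE !eqxx !mulr1 big1 ?addr0.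
    by rewrite -[RHS]/(_ * _) mulr1.
  by move=> S' /andP[_ nS]; rewrite !ffunE (negPf nS) mul0r mulr0.
rewrite big1 => [|S' SU].
  case: ifP nU => dST /= nU; rewrite !ffunE //.
  by rewrite (negPf nU) [RHS]mulr0.
rewrite !ffunE; have [ES|] := eqVneq S' S; last by rewrite mul0r mulr0.
have [ET|] := eqVneq; last by rewrite mulr0 mulr0.
case/negP: nU; rewrite -ET -ES -setI_eq0 setIDA setDIl setDv set0I eqxx /=.
by rewrite -{1}(setIidPr SU) setID.
Qed.

Lemma wedgeDl : left_distributive (@wedge K m) +%R.
Proof.
move=> a b c; apply/ffunP=> U; rewrite !ffunE -big_split /=.
by apply: eq_bigr => S _; rewrite !ffunE mulrDl mulrDr.
Qed.

Lemma wedgeDr : right_distributive (@wedge K m) +%R.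
Proof.
move=> a b c; apply/ffunP=> U; rewrite !ffunE -big_split /=.
by apply: eq_bigr => S _; rewrite !ffunE mulrDr mulrDr.
Qed.

Lemma wedgeZl k a b : wedge (k *: a) b = k *: wedge a b.
Proof.
apply/ffunP=> U; rewrite !ffunE -[RHS]/(_ * _) mulr_sumr.
apply: eq_bigr => S _; rewrite ffunE -[(k *: _ : K^o)]/(_ * _).
by rewrite -mulrA [LHS](@mulrCA K).
Qed.

Lemma wedgeZr k a b : wedge a (k *: b) = k *: wedge a b.
Proof.
apply/ffunP=> U; rewrite !ffunE -[RHS]/(_ * _) mulr_sumr.
apply: eq_bigr => S _; rewrite ffunE -[(k *: _ : K^o)]/(_ * _).
by rewrite [X in _ * X](@mulrCA K) [LHS](@mulrCA K).
Qed.

Lemma wedge0l a : wedge 0 a = 0.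
Proof. by rewrite -(scale0r 0) wedgeZl !scale0r. Qed.

Lemma wedge0r a : wedge a 0 = 0.
Proof. by rewrite -(scale0r 0) wedgeZr !scale0r. Qed.

Lemma wedge_suml (I : Type) (r : seq I) (P : pred I) (F : I -> ext K m) a :
  wedge (\sum_(i <- r | P i) F i) a = \sum_(i <- r | P i) wedge (F i) a.
Proof.
by apply: (big_morph (fun b => wedge b a)) => [b c|]; rewrite (wedgeDl, wedge0l).
Qed.

Lemma wedge_sumr (I : Type) (r : seq I) (P : pred I) (F : I -> ext K m) a :
  wedge a (\sum_(i <- r | P i) F i) = \sum_(i <- r | P i) wedge a (F i).
Proof.
by apply: (big_morph (wedge a)) => [b c|]; rewrite (wedgeDr, wedge0r).
Qed.

(** On basis vectors both sides vanish unless S, T, U are pairwise disjoint, and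
    then both signs count the inversions between S and T, S and U, T and U. *)
Lemma wedgeA : associative (@wedge K m).
Proof.
move=> a b c; rewrite [a]ext_decomp [b]ext_decomp [c]ext_decomp.
rewrite [LHS]wedge_suml [in RHS]wedge_suml [RHS]wedge_suml.
apply: eq_bigr => S _.
rewrite [in LHS]wedge_suml [LHS]wedge_sumr.
rewrite [X in _ = wedge X _]wedge_sumr [RHS]wedge_suml.
apply: eq_bigr => T _.
rewrite [in LHS]wedge_sumr [LHS]wedge_sumr [RHS]wedge_sumr.
apply: eq_bigr => U _.
rewrite !wedgeZl !wedgeZr !wedgeZl [in RHS](scalerA (c U)) (mulrC (c U)).
rewrite -[in RHS]scalerA; congr (_ *: (_ *: (_ *: _))).
rewrite !wedge_basis.
have dUU : [disjoint T & U] ->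
    [disjoint S & T :|: U] = [disjoint S & T] && [disjoint S & U].
  by move=> _; rewrite -!setI_eq0 setIUr setU_eq0.
have dUU' : [disjoint S & T] ->
    [disjoint S :|: T & U] = [disjoint S & U] && [disjoint T & U].
  by move=> _; rewrite -!setI_eq0 setIUl setU_eq0.
have [dTU|dTU] := boolP [disjoint T & U];
  have [dST|dST] := boolP [disjoint S & T];
  rewrite ?(wedgeZl, wedgeZr) ?wedge_basis ?wedge0l ?wedge0r ?dUU ?dUU' //
    ?dST ?dTU ?(negPf dST) ?(negPf dTU) ?andbF ?scaler0 //= andbT.
have [dSU|] := boolP [disjoint S & U]; last by rewrite !scaler0.
rewrite !scalerA -!exprD finset.setUA inversionsUl // inversionsUr //.
by rewrite addnC -addnA.
Qed.

Lemma wedge1l : left_id ext_one (@wedge K m).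
Proof.
move=> a; rewrite [a]ext_decomp wedge_sumr; apply: eq_bigr => S _.
by rewrite wedgeZr wedge_basis -setI_eq0 finset.set0I eqxx inversions0l scale1r
  finset.set0U.
Qed.

Lemma wedge1r : right_id ext_one (@wedge K m).
Proof.
move=> a; rewrite [a]ext_decomp wedge_suml; apply: eq_bigr => S _.
by rewrite wedgeZl wedge_basis -setI_eq0 finset.setI0 eqxx inversions0r scale1r
  finset.setU0.
Qed.

Lemma ext_one_neq0 : ext_one != 0 :> ext K m.
Proof.
apply/eqP=> /ffunP/(_ finset.set0); rewrite !ffunE eqxx => /eqP.
by rewrite oner_eq0.
Qed.

HB.instance Definition _ := GRing.Zmodule_isNzRing.Build (ext K m)
  wedgeA wedge1l wedge1r wedgeDl wedgeDr ext_one_neq0.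
HB.instance Definition _ := GRing.Lmodule_isLalgebra.Build K (ext K m)
  (fun k a b => esym (wedgeZl k a b)).
HB.instance Definition _ := GRing.Lalgebra_isAlgebra.Build K (ext K m)
  (fun k a b => esym (wedgeZr k a b)).

Lemma wedge_expE a k : wedge_exp a k = a ^+ k.
Proof. by elim: k => [|k IH] //; rewrite exprS -IH. Qed.

End ExteriorRing.

(** * Forms of degree one *)

Section DegreeOne.
Variables (K : comNzRingType) (m : nat).
Implicit Types (a b : ext K m) (u v : 'I_m -> K) (T : {set 'I_m}).

Definition ext_lin v : ext K m := \sum_i v i *: ext_gen i.

Lemma ext_lin_basis v T :
  ext_lin v * ext_basis K T = (-1) ^+ #|T| *: (ext_basis K T * ext_lin v).
Proof.
rewrite mulr_suml mulr_sumr scaler_sumr; apply: eq_bigr => i _.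
rewrite -scalerAl -scalerAr scalerA (mulrC _ (v i)) -scalerA; congr (_ *: _).
rewrite -[LHS]/(wedge _ _) -[ext_basis K T * _]/(wedge _ _).
rewrite !wedge_basis disjoint_sym; case: ifP => dTi; last by rewrite scaler0.
rewrite finset.setUC scalerA; congr (_ *: _).
rewrite -[#|T|]muln1 -(cards1 i) -inversions_sym // exprD mulrAC.
by rewrite -expr2 sqrr_sign mul1r.
Qed.

Lemma ext_lin_anticomm u v : ext_lin u * ext_lin v = - (ext_lin v * ext_lin u).
Proof.
rewrite [LHS]mulr_sumr [in RHS]mulr_suml -sumrN; apply: eq_bigr => i _.
by rewrite -scalerAl -scalerAr ext_lin_basis cards1 expr1 scaleN1r scalerN.
Qed.

(** Moving two factors of degree one past a basis vector of degree k gives twice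
    the sign (-1)^k. *)
Lemma ext_lin2_central u v a :
  ext_lin u * ext_lin v * a = a * (ext_lin u * ext_lin v).
Proof.
rewrite [a]ext_decomp [LHS]mulr_sumr [RHS]mulr_suml; apply: eq_bigr => T _.
rewrite -scalerAl -scalerAr; congr (_ *: _).
rewrite -mulrA ext_lin_basis -scalerAr mulrA ext_lin_basis -scalerAl scalerA.
by rewrite -expr2 sqrr_sign scale1r mulrA.
Qed.

End DegreeOne.

Lemma ext_lin_sqr0 (K : numDomainType) (m : nat) (v : 'I_m -> K) :
  ext_lin v * ext_lin v = 0.
Proof.
have /eqP := ext_lin_anticomm v v; rewrite -addr_eq0 -mulr2n -scaler_nat.
move=> /eqP/ffunP E; apply/ffunP=> T; have := E T; rewrite !ffunE => /eqP.
by rewrite mulf_eq0 pnatr_eq0 /= => /eqP.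
Qed.

(** * Products of commuting or anticommuting elements *)

Section Words.
Variable I : eqType.
Implicit Types s t : seq I.

(** The exponent b lets one statement serve commuting (b = false) and
    anticommuting (b = true) families. *)
Lemma prod_moveout (E : nzRingType) (e : I -> E) (b : bool) (x : I) s :
    (forall i j, e i * e j = (-1) ^+ b * (e j * e i)) ->
  (\prod_(i <- s) e i) * e x = (-1) ^+ (b * size s) * (e x * \prod_(i <- s) e i).
Proof.
move=> com; elim: s => [|y s IH].
  by rewrite big_nil muln0 expr0 mul1r mulr1 mul1r.
rewrite big_cons -mulrA IH (mulrA (e y)) (commr_sign (e y)) -!mulrA.
by rewrite (mulrA (e y)) com mulnS addnC exprD -!mulrA.
Qed.

(** Bubble sort: each letter of t is moved to the front of s in turn.  The sign
    depends only on the words, not on the algebra in which they are evaluated: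
    [prod_lin_comb] needs this uniformity. *)
Lemma perm_prod_sign s t : perm_eq s t ->
  exists k, forall (E : nzRingType) (e : I -> E) (b : bool),
    (forall i j, e i * e j = (-1) ^+ b * (e j * e i)) ->
    \prod_(i <- s) e i = (-1) ^+ (b * k) * \prod_(i <- t) e i.
Proof.
elim: t s => [|x t IH] s st.
  by move/perm_nilP: st => ->; exists 0%N => E e b _; rewrite !muln0 mul1r.
have xs : x \in s by rewrite (perm_mem st) mem_head.
case/splitPr: xs st => s1 s2; rewrite (perm_catCA s1 [:: x] s2) /= perm_cons.
case/IH=> k Ek; exists (size s1 + k)%N => E e b com.
rewrite big_cat !big_cons /= mulrA (prod_moveout x s1 com) -!mulrA -big_cat /=.
rewrite (Ek _ _ _ com) mulnDr exprD -!mulrA; congr (_ * _).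
rewrite !mulrA; congr (_ * _).
by rewrite (commr_sign (e x)).
Qed.

Lemma notuniq_perm s : ~~ uniq s -> exists x t, perm_eq s [:: x, x & t].
Proof.
elim: s => //= x s IH; rewrite negb_and negbK; case/orP=> [xs|/IH[y [t st]]].
  by exists x, (rem x s); rewrite perm_cons perm_to_rem.
exists y, (x :: t); rewrite -(perm_cons x) in st; apply: perm_trans st _.
by rewrite (perm_catCA [:: x] [:: y; y] t).
Qed.

Lemma prod_notuniq (E : nzRingType) (e : I -> E) (b : bool) s :
    (forall i j, e i * e j = (-1) ^+ b * (e j * e i)) ->
    (forall i, e i * e i = 0) ->
  ~~ uniq s -> \prod_(i <- s) e i = 0.
Proof.
move=> com sqr0 /notuniq_perm[x [t /perm_prod_sign[k Ek]]]; rewrite (Ek _ _ _ com).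
by rewrite !big_cons mulrA sqr0 mul0r mulr0.
Qed.

End Words.

Lemma prodr_enum (E : nzRingType) (I : finType) (e : I -> E) :
  \prod_(i <- enum I) e i = \prod_i e i.
Proof. by rewrite [index_enum _]unlock enumT. Qed.

(** The integer c is the sign of f if f is a permutation, and 0 otherwise, since
    a repeated letter can be brought next to itself. *)
Lemma word_sign (n : nat) (f : {ffun 'I_n -> 'I_n}) :
  exists c : int, forall (E : nzRingType) (e : 'I_n -> E),
    (forall i j, e i * e j = - (e j * e i)) -> (forall i, e i * e i = 0) ->
    \prod_i e (f i) = c%:~R * \prod_i e i.
Proof.
have ef (E : nzRingType) (e : 'I_n -> E) :
    \prod_i e (f i) = \prod_(i <- map f (enum 'I_n)) e i.
  by rewrite big_map prodr_enum.
have [Uf|nUf] := boolP (uniq (map f (enum 'I_n))); last first.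
  exists 0 => E e anti sqr0; rewrite ef mul0r.
  by apply: (prod_notuniq (b := true)) => // i j; rewrite anti mulN1r.
have /perm_prod_sign[k Ek] : perm_eq (map f (enum 'I_n)) (enum 'I_n).
  apply: uniq_perm => //; first exact: enum_uniq.
  have [] := uniq_min_size Uf (s2 := enum 'I_n); rewrite ?size_map //.
  by move=> i; rewrite mem_enum.
exists ((-1) ^+ k) => E e anti sqr0.
rewrite ef (Ek E e true) => [|i j]; last by rewrite anti mulN1r.
by rewrite mul1n rmorphXn rmorphN rmorph1 prodr_enum.
Qed.

(** The scalar on the right is the determinant of A in Leibniz form.  All that
    is needed of it is that it is the same polynomial in the entries of A, with
    integer coefficients, for every anticommuting family: conjugating A thus
    conjugates the scalar. *)
Lemma prod_lin_comb (n : nat) :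
  exists c : {ffun 'I_n -> 'I_n} -> int,
  forall (K : comNzRingType) (E : algType K) (e : 'I_n -> E) (A : 'M[K]_n),
    (forall i j, e i * e j = - (e j * e i)) -> (forall i, e i * e i = 0) ->
    \prod_i (\sum_j A i j *: e j) =
      (\sum_f (c f)%:~R * \prod_i A i (f i)) *: \prod_i e i.
Proof.
have [c Ec] := fin_all_exists (@word_sign n).
exists c => K E e A anti sqr0; rewrite bigA_distr_bigA scaler_suml.
apply: eq_bigr => f _; rewrite scaler_prod (Ec _ _ _ anti sqr0).
by rewrite !mulrzl -scalerMzl scalerMzr.
Qed.

(** * The algebra generated by commuting elements of square zero *)

Section SquareZero.
Variables (K : comNzRingType) (E : algType K) (I : finType) (w : I -> E).
Hypothesis wC : forall i j, w i * w j = w j * w i.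
Hypothesis w_sqr0 : forall i, w i * w i = 0.
Implicit Types (J : {set I}) (mu : {set I} -> K) (c : I -> K).

Definition mono J : E := \prod_(i <- enum J) w i.
Definition mono_comb mu : E := \sum_J mu J *: mono J.

Lemma prod_perm_comm s t : perm_eq s t ->
  \prod_(i <- s) w i = \prod_(i <- t) w i.
Proof.
case/perm_prod_sign=> k Ek; rewrite (Ek E w false) ?mul0n ?mul1r //.
by move=> i j; rewrite mul1r.
Qed.

(** The monomials in the w i multiply like the square-free monomials in a
    polynomial algebra modulo the squares of the variables. *)
Lemma mono_mul J1 J2 :
  mono J1 * mono J2 = if [disjoint J1 & J2] then mono (J1 :|: J2) else 0.
Proof.
rewrite /mono -big_cat /=; case: ifP => dJ.
  apply: prod_perm_comm; apply: uniq_perm; rewrite ?enum_uniq //.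
    rewrite cat_uniq !enum_uniq andbT /=; apply/hasPn=> i; rewrite !mem_enum.
    by move=> iJ2; rewrite (disjointFl dJ iJ2).
  by move=> i; rewrite mem_cat !mem_enum inE.
apply: (prod_notuniq (b := false)) => // [i j|]; first by rewrite mul1r.
rewrite cat_uniq !enum_uniq andbT /= negbK; move/negbT: dJ.
rewrite -setI_eq0 => /finset.set0Pn[i /finset.setIP[iJ1 iJ2]].
by apply/hasP; exists i; rewrite /= mem_enum.
Qed.

Lemma mono1 i : mono [set i]%SET = w i.
Proof. by rewrite /mono enum_set1 big_seq1. Qed.

Lemma mono0 : mono finset.set0 = 1.
Proof. by rewrite /mono enum_set0 big_nil. Qed.

(** Each J is reached from J :\ i by multiplying with w i, once for each i in
    J. *)
Lemma mul_mono_comb c mu :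
  (\sum_i c i *: w i) * mono_comb mu =
  mono_comb (fun J => \sum_(i in J) c i * mu (J :\ i)%SET).
Proof.
rewrite mulr_suml /mono_comb.
under [RHS]eq_bigr => J _ do rewrite scaler_suml big_mkcond /=.
rewrite exchange_big /=; apply: eq_bigr => i _.
rewrite -big_mkcond mulr_sumr (bigID (fun J : {set I} => i \in J)) /=.
rewrite big1 ?add0r => [|J iJ]; last first.
  rewrite -scalerAl -scalerAr -mono1 mono_mul disjoints1 iJ.
  by rewrite !scaler0.
rewrite (reindex_onto (fun J => J :\ i)%SET (fun J => i |: J)%SET) /=; last first.
  by move=> J iJ; rewrite setU1K.
apply: eq_big => J.
  rewrite setD11 /=; apply/eqP/idP => [<-|/finset.setD1K //].
  by rewrite finset.setU11.
rewrite setD11 /= => /eqP EJ.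
rewrite -scalerAl -scalerAr -mono1 mono_mul disjoints1 setD11 /= EJ.
by rewrite scalerA.
Qed.

(** The factor k! counts the orders in which the k elements of J are
    picked. *)
Lemma exp_mono_comb c k :
  (\sum_i c i *: w i) ^+ k =
  mono_comb (fun J => ((#|J| == k) * k`!)%N%:R * \prod_(i in J) c i).
Proof.
elim: k => [|k IH].
  rewrite expr0 /mono_comb (bigD1 finset.set0) //= [X in _ + X]big1 ?addr0.
    by rewrite cards0 mul1r finset.big_set0 scale1r mono0.
  by move=> J /negPf J0; rewrite cards_eq0 J0 mul0n mul0r scale0r.
rewrite exprS IH mul_mono_comb; apply: eq_bigr => J _; congr (_ *: _).
transitivity (\sum_(i in J) ((#|J| == k.+1) * k`!)%N%:R * \prod_(i in J) c i);
  last first.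
  rewrite sumr_const -mulrnAl -mulrnA; congr (_%:R * _).
  by case: eqP => [->|_]; rewrite ?mul0n // !mul1n factS mulnC.
apply: eq_bigr => i iJ; rewrite mulrCA -(big_setD1 i) //.
by rewrite [in RHS](cardsD1 i J) iJ.
Qed.

(** The case of one factor beta among powers of alpha, as in the second
    inequality. *)
Lemma mul_exp_mono_comb c k :
  (\sum_i c i *: w i) * (\sum_i w i) ^+ k =
  mono_comb (fun J => ((#|J| == k.+1) * k`!)%N%:R * \sum_(i in J) c i).
Proof.
rewrite -[\sum_i w i](eq_bigr _ (fun i _ => scale1r (w i))) exp_mono_comb.
rewrite mul_mono_comb; apply: eq_bigr => J _; congr (_ *: _).
rewrite mulr_sumr; apply: eq_bigr => i iJ; rewrite big1 // mulr1 mulrC.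
by rewrite (cardsD1 i J) iJ.
Qed.

Lemma exp_mono_comb1 k :
  (\sum_i w i) ^+ k = mono_comb (fun J => ((#|J| == k) * k`!)%N%:R).
Proof.
rewrite -[\sum_i w i](eq_bigr _ (fun i _ => scale1r (w i))) exp_mono_comb.
by apply: eq_bigr => J _; rewrite big1 // mulr1.
Qed.

Lemma mono_comb_full mu : (forall J, #|J| != #|I| -> mu J = 0) ->
  mono_comb mu = mu [set: I]%SET *: mono [set: I]%SET.
Proof.
move=> mu0; rewrite /mono_comb (bigD1 [set: I]%SET) //= big1 ?addr0 // => J nJ.
rewrite mu0 ?scale0r //; apply: contraNneq nJ => cJ.
by rewrite eqEcard finset.subsetT cardsT cJ /=.
Qed.

(** Only the complement of J contributes to the product with the monomial of J:
    the degrees add up to the number of variables. *)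
Lemma exp_mul_exp c p : (p <= #|I|)%N ->
  (\sum_i w i) ^+ (#|I| - p) * (\sum_i c i *: w i) ^+ p =
  ((#|I| - p)`! * p`!)%:R * (\sum_(J : {set I} | #|J| == p) \prod_(i in J) c i)
    *: mono [set: I]%SET.
Proof.
move=> lep; rewrite exp_mono_comb exp_mono_comb1 mulr_sumr mulr_sumr.
rewrite scaler_suml [RHS]big_mkcond; apply: eq_bigr => J _.
case: eqP => [cJ|_]; last by rewrite mul0n mul0r scale0r mulr0.
rewrite -scalerAr mul1n mulr_suml (bigD1 (~: J)%SET) //= [X in _ + X]big1 ?addr0.
  rewrite -scalerAl mono_mul disjoints_subset subxx finset.setUC finset.setUCr scalerA.
  rewrite cardsCs finset.setCK cJ eqxx mul1n natrM.
  by rewrite mulrAC (mulrC p`!%:R).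
move=> J' nJ'; rewrite -scalerAl mono_mul.
case: eqP => [cJ'|_]; last by rewrite scale0r.
case: ifP => dJ; last by rewrite scaler0.
case/eqP: nJ'; apply/eqP; rewrite eqEcard -disjoints_subset dJ.
by rewrite cardsCs finset.setCK cJ cJ' leqnn.
Qed.

End SquareZero.

(** * Simultaneous diagonalization of two Hermitian matrices *)

Section SimultaneousDiagonalization.
Variable C : numClosedFieldType.
Local Open Scope sesquilinear_scope.

Definition hermitian_pos n (H : 'M[C]_n) :=
  (forall j k, H k j = (H j k)^*) /\
  forall v : 'rV[C]_n, v != 0 ->
    0 < \sum_(j < n) \sum_(k < n) H j k * v 0 j * (v 0 k)^*.

Lemma trmxC_mul m n p (A : 'M[C]_(m, n)) (B : 'M[C]_(n, p)) :
  (A *m B)^t* = B^t* *m A^t*.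
Proof. by rewrite trmx_mul map_mxM. Qed.

Lemma hermitian_posE n (H : 'M[C]_n) :
  hermitian_pos H <->
  H^t* = H /\ forall v : 'rV[C]_n, v != 0 -> 0 < (v *m H *m v^t*) 0 0.
Proof.
have formE (v : 'rV[C]_n) : (v *m H *m v^t*) 0 0 =
    \sum_(j < n) \sum_(k < n) H j k * v 0 j * (v 0 k)^*.
  rewrite exchange_big mxE; apply: eq_bigr => k _; rewrite !mxE mulr_suml.
  by apply: eq_bigr => j _; rewrite (mulrC (v 0 j)).
split=> -[herm pos]; split.
- by apply/matrixP=> j k; rewrite !mxE -herm.
- by move=> v /pos; rewrite formE.
- by move=> j k; rewrite -{1}herm !mxE.
- by move=> v /pos; rewrite formE.
Qed.

Lemma hermitian_pos_congr n (H T : 'M[C]_n) :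
  T \in unitmx -> hermitian_pos H -> hermitian_pos (T *m H *m T^t*).
Proof.
move=> Tu /hermitian_posE[herm pos]; apply/hermitian_posE; split.
  by rewrite !trmxC_mul trmxCK herm mulmxA.
move=> v v0; have := pos (v *m T); rewrite trmxC_mul !mulmxA; apply.
by apply: contra v0 => /eqP vT; rewrite -(mulmxK Tu v) vT mul0mx.
Qed.

(** The spectral theorem; the eigenvalues are positive because the diagonal
    matrix is congruent to H. *)
Lemma hermitian_pos_diag n (H : 'M[C]_n) : hermitian_pos H ->
  exists (P : 'M[C]_n) (d : 'I_n -> C),
    [/\ P \is unitarymx, forall i, 0 < d i &
        H = P^t* *m diag_mx (\row_i d i) *m P].
Proof.
move=> Hpos; have [herm _] := (hermitian_posE H).1 Hpos.
have /orthomx_spectralP/= : H \is normalmx by apply/normalmxP; rewrite herm.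
set P := spectralmx H; set d := spectral_diag H => Hd.
have PU : P \is unitarymx by apply: spectral_unitarymx.
have Pu := unitarymx_unit PU; exists P, (d 0).
have rowd : \row_i d 0 i = d by apply/rowP=> i; rewrite mxE.
rewrite rowd -(invmx_unitary PU); split=> // i.
have := (hermitian_posE _).1 (hermitian_pos_congr Pu Hpos).
rewrite Hd -(invmx_unitary PU) !mulmxA mulmxV // mul1mx mulmxK //.
case=> _ /(_ (delta_mx 0 i)).
rewrite -rowE row_diag_mx mxE (bigD1 i) //= big1 => [|k /negPf ki].
  rewrite !mxE !eqxx /= conjC1 !mulr1 addr0; apply.
  by apply/eqP=> /matrixP/(_ 0 i)/eqP; rewrite !mxE !eqxx oner_eq0.
by rewrite !mxE ki andbF mulr0 mul0r.
Qed.

Lemma congr_diag_mxE n (M : 'M[C]_n) (d : 'I_n -> C) j k :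
  (M^t* *m diag_mx (\row_i d i) *m M) j k =
  \sum_i d i * ((map_mx Num.conj M) i j * ((map_mx Num.conj M) i k)^*).
Proof.
rewrite mxE; apply: eq_bigr => i _.
by rewrite mul_mx_diag !mxE conjCK mulrAC mulrC.
Qed.

(** With G = S^* S for an invertible S, the matrix S^-* H S^-1 is again positive
    definite, hence equal to Q^* diag(l) Q with Q unitary.  Then Q S brings G to
    the identity and H to diag(l).  The matrix A is its entrywise conjugate,
    because the first index of G belongs to dz and the second to its
    conjugate. *)
Lemma simultaneous_diag n (G H : 'M[C]_n) :
  hermitian_pos G -> hermitian_pos H ->
  exists (A : 'M[C]_n) (l : 'I_n -> C),
    [/\ A \in unitmx, forall i, 0 < l i,
        forall j k, G j k = \sum_i A i j * (A i k)^* &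
        forall j k, H j k = \sum_i l i * (A i j * (A i k)^*)].
Proof.
move=> /hermitian_pos_diag[P [d [PU d0 GE]]] Hpos.
pose D := diag_mx (\row_i sqrtC (d i)).
have Dt : D^t* = D.
  rewrite tr_diag_mx map_diag_mx; congr diag_mx; apply/rowP=> i; rewrite !mxE.
  by apply/CrealP/ger0_real; rewrite sqrtC_ge0 ltW.
pose S := D *m P.
have Su : S \in unitmx.
  rewrite unitmx_mul (unitarymx_unit PU) andbT unitmxE det_diag unitfE.
  by apply/prodf_neq0 => i _; rewrite mxE sqrtC_eq0 gt_eqF.
have GS : G = S^t* *m S.
  rewrite GE trmxC_mul Dt !mulmxA -(mulmxA _ D D); congr (_ *m _ *m _).
  rewrite mulmx_diag; congr diag_mx; apply/rowP=> i.
  by rewrite !mxE -expr2 sqrtCK.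
pose T := (invmx S)^t*.
have TS : T^t* = invmx S by rewrite trmxCK.
have ST : S^t* *m T = 1%:M by rewrite -trmxC_mul mulVmx // trmx1 map_mx1.
have Tu : T \in unitmx by rewrite map_unitmx unitmx_tr unitmx_inv.
have [Q [l [QU l0 HE]]] := hermitian_pos_diag (hermitian_pos_congr Tu Hpos).
pose M := Q *m S; exists (map_mx Num.conj M), l; split=> // [|j k|j k].
- by rewrite map_unitmx unitmx_mul (unitarymx_unit QU).
- rewrite (eq_bigr _ (fun i _ => esym (mul1r _))).
  rewrite -(congr_diag_mxE M (fun=> 1)) trmxC_mul.
  have -> : diag_mx (\row__ 1) = 1%:M :> 'M[C]_n.
    by apply/matrixP=> i i'; rewrite !mxE.
  rewrite mulmx1 GS -(invmx_unitary QU) /M mulmxA.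
  by rewrite mulmxKV ?unitarymx_unit.
rewrite -congr_diag_mxE trmxC_mul /M.
have -> : S^t* *m Q^t* *m diag_mx (\row_i l i) *m (Q *m S) =
  S^t* *m (Q^t* *m diag_mx (\row_i l i) *m Q) *m S by rewrite !mulmxA.
by rewrite -HE TS 2!mulmxA ST mul1mx mulmxKV.
Qed.

End SimultaneousDiagonalization.

(** * Linear forms of types (1,0) and (0,1) *)

Section LinearForms.
Variables (K : comNzRingType) (m : nat).
Implicit Types (v : 'I_m -> K) (S : {set 'I_m}).

Lemma ext_lin_not1 v S : (forall i, S != [set i]%SET) -> ext_lin v S = 0.
Proof.
move=> nS; rewrite sum_ffunE big1 // => i _.
by rewrite !ffunE (negPf (nS i)) [LHS]mulr0.
Qed.

Lemma ext_lin_set1 v i : ext_lin v [set i]%SET = v i.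
Proof.
rewrite sum_ffunE (bigD1 i) //= big1 => [|j /negPf ji].
  by rewrite !ffunE eqxx addr0 [LHS]mulr1.
by rewrite !ffunE (inj_eq set1_inj) eq_sym ji [LHS]mulr0.
Qed.

(** Conjugation of forms is an extension of this kind; on (1,0)-forms it is
    thus conjugation of the coefficients. *)
Lemma ext_lift_lin m2 (s : K -> K) (f : 'I_m -> ext K m2) v :
  s 0 = 0 -> ext_lift s f (ext_lin v) = \sum_i s (v i) *: f i.
Proof.
move=> s0; rewrite /ext_lift (bigID (mem [set [set i]%SET | i : 'I_m]%SET)) /=.
rewrite [X in _ + X]big1 ?addr0 => [|S /imsetP nS]; last first.
  rewrite ext_lin_not1 ?s0 ?scale0r // => i; apply/eqP=> Si.
  by apply: nS; exists i.
rewrite big_imset /=; last by move=> i j _ _; apply: set1_inj.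
apply: eq_big => // i _; rewrite ext_lin_set1 enum_set1.
by rewrite big_cons big_nil wedge1r.
Qed.

(** Products of distinct generators do not vanish. *)
Lemma prod_gen_basis (s : seq 'I_m) : uniq s ->
  exists k, \prod_(i <- s) ext_gen i =
            (-1) ^+ k *: ext_basis K [set i in s]%SET.
Proof.
elim: s => [_|i s IH /= /andP[nis /IH[k Ek]]].
  by exists 0%N; rewrite big_nil scale1r; congr (ext_basis _ _).
rewrite big_cons Ek -scalerAr -[_ * _]/(wedge _ _) wedge_basis.
have -> : [disjoint [set i]%SET & [set j in s]%SET].
  by rewrite disjoints1 inE.
eexists; rewrite scalerA -exprD; congr (_ *: ext_basis _ _).
by apply/setP=> j; rewrite !inE.
Qed.

End LinearForms.

(** As in [perm_prod_sign], the sign is the same for all families: it cancels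
    when two products of pairs are compared. *)
Lemma prod_pairs (I : eqType) (r : seq I) :
  exists k, forall (E : nzRingType) (x y : I -> E),
    (forall i j, x i * y j = - (y j * x i)) ->
    \prod_(i <- r) (x i * y i) =
      (-1) ^+ k * (\prod_(i <- r) x i * \prod_(i <- r) y i).
Proof.
have move_y (E : nzRingType) (x y : I -> E) s j :
    (forall i j, x i * y j = - (y j * x i)) ->
    y j * (\prod_(i <- s) x i) = (-1) ^+ size s * (\prod_(i <- s) x i * y j).
  move=> anti; elim: s => [|i s IH]; first by rewrite big_nil !mul1r mulr1.
  rewrite big_cons mulrA -[y j * x i]opprK -anti mulNr -[in LHS]mulrA IH.
  by rewrite (mulrA (x i)) (commr_sign (x i)) /= exprS mulN1r mulNr -!mulrA.
elim: r => [|i r [k IH]].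
  by exists 0%N => E x y _; rewrite !big_nil !mul1r.
exists (k + size r)%N => E x y anti; rewrite !big_cons (IH E x y anti).
rewrite [LHS]mulrA (commr_sign (x i * y i)) -[LHS]mulrA exprD -[RHS]mulrA.
congr (_ * _); rewrite -[LHS]mulrA [y i * (_ * _)]mulrA move_y // !mulrA.
by rewrite (commr_sign (x i)).
Qed.

Lemma sum_split_ord (V : nmodType) (m1 m2 : nat) (F : 'I_(m1 + m2) -> V) :
  \sum_i F i = \sum_i F (lshift m2 i) + \sum_i F (rshift m1 i).
Proof. exact: big_split_ord. Qed.

Section CoframeAtAPoint.
Variables (R : realType) (n : nat).
Local Notation C := R[i].
Local Notation cform := (ext C (n + n)).
Implicit Types (a : 'I_n -> C) (A : 'M[C]_n).

Definition form10 a : cform := \sum_j a j *: dz R j.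
Definition form01 a : cform := \sum_j a j *: dzbar R j.

Lemma form10_lin a : form10 a =
  ext_lin (fun i => match fintype.split i with inl j => a j | inr _ => 0 end).
Proof.
rewrite /ext_lin sum_split_ord [X in _ = _ + X]big1 ?addr0 => [|j _].
  by apply: eq_bigr => j _; rewrite (unsplitK (inl _ j)).
by rewrite (unsplitK (inr _ j)) scale0r.
Qed.

Lemma form01_lin a : form01 a =
  ext_lin (fun i => match fintype.split i with inl _ => 0 | inr j => a j end).
Proof.
rewrite /ext_lin sum_split_ord [X in _ = X + _]big1 ?add0r => [|j _].
  by apply: eq_bigr => j _; rewrite (unsplitK (inr _ j)).
by rewrite (unsplitK (inl _ j)) scale0r.
Qed.

Lemma conj_form10 a : conj_form (form10 a) = form01 (fun j => (a j)^*).
Proof.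
rewrite form10_lin /conj_form ext_lift_lin; last exact: rmorph0.
rewrite sum_split_ord [X in _ + X]big1 ?addr0 => [|j _].
  by apply: eq_bigr => j _; rewrite (unsplitK (inl _ j)).
by rewrite (unsplitK (inr _ j)) -[(0^*)%C]/((0 : C)^*) rmorph0 scale0r.
Qed.

Lemma bidegree_form10 a : has_bidegree 1 0 (form10 a).
Proof.
move=> S; rewrite form10_lin => nz.
have [i SE] : exists i, S = [set i]%SET.
  apply: contrapT => /forallNP nS; move/eqP: nz; apply; apply: ext_lin_not1.
  by move=> i; apply/eqP.
move: nz; rewrite {}SE ext_lin_set1; case: split_ordP => j -> nz; last first.
  by rewrite eqxx in nz.
split; last by apply/eqP; rewrite cards_eq0; apply/eqP/setP=> k;
  rewrite !inE eq_rlshift.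
rewrite -[RHS](cards1 j); congr #|pred_of_set _|; apply/setP=> k.
by rewrite !inE (inj_eq (@lshift_inj _ _)).
Qed.

End CoframeAtAPoint.

(** * The volume of a coframe *)

Section Coframe.
Variables (R : realType) (n : nat).
Local Notation C := R[i].
Local Notation cform := (ext C (n + n)).
Implicit Types (A B : 'M[C]_n).

Definition coframe A i : cform := form10 (A i).
Definition coframe_bar A i : cform := form01 (fun j => (A i j)^*).
Definition coframe11 A i : cform := 'i%C *: (coframe A i * coframe_bar A i).

Lemma coframe_lin A i : exists v, coframe A i = ext_lin v.
Proof. by rewrite /coframe form10_lin; eexists. Qed.

Lemma coframe_bar_lin A i : exists v, coframe_bar A i = ext_lin v.
Proof. by rewrite /coframe_bar form01_lin; eexists. Qed.

Lemma coframe11_central A i (a : cform) : coframe11 A i * a = a * coframe11 A i.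
Proof.
rewrite /coframe11; have [u ->] := coframe_lin A i.
have [v ->] := coframe_bar_lin A i.
by rewrite -scalerAl -scalerAr ext_lin2_central.
Qed.

Lemma coframe11_sqr0 A i : coframe11 A i * coframe11 A i = 0.
Proof.
rewrite {2}/coframe11 -scalerAr mulrA coframe11_central /coframe11.
have [u ->] := coframe_lin A i; rewrite -scalerAr mulrA.
by rewrite ext_lin_sqr0 mul0r scaler0 mul0r scaler0.
Qed.

Lemma dz_lin j : exists v, dz R j = ext_lin v :> cform.
Proof.
exists (fun i => (i == lshift n j)%:R); rewrite /ext_lin (bigD1 (lshift n j)) //=.
by rewrite big1 ?addr0 ?eqxx ?scale1r // => i /negPf ->; rewrite scale0r.
Qed.

Lemma dzbar_lin j : exists v, dzbar R j = ext_lin v :> cform.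
Proof.
exists (fun i => (i == rshift n j)%:R); rewrite /ext_lin (bigD1 (rshift n j)) //=.
by rewrite big1 ?addr0 ?eqxx ?scale1r // => i /negPf ->; rewrite scale0r.
Qed.

Lemma volume_neq0 : volume_form R n != 0.
Proof.
have [k Ek] := prod_pairs (enum 'I_n).
rewrite /volume_form -[\big[_/_]_(_ <- _) _]/(\prod_(j <- enum 'I_n)
  ('i%C *: (dz R j * dzbar R j : cform))) scaler_prod Ek; last first.
  move=> i j; have [u ->] := dz_lin i; have [v ->] := dzbar_lin j.
  exact: ext_lin_anticomm.
have [l El] : exists l, \prod_(j <- enum 'I_n) dz R j *
    \prod_(j <- enum 'I_n) dzbar R j = (-1) ^+ l *:
      ext_basis C [set i in map (@lshift n n) (enum 'I_n) ++
                           map (@rshift n n) (enum 'I_n)]%SET :> cform.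
  rewrite -(big_map (@lshift n n) xpredT (@ext_gen C (n + n))).
  rewrite -(big_map (@rshift n n) xpredT (@ext_gen C (n + n))) -big_cat /=.
  apply: prod_gen_basis; rewrite cat_uniq (map_inj_uniq (@lshift_inj _ _)).
  rewrite (map_inj_uniq (@rshift_inj _ _)) !enum_uniq andbT /=.
  by apply/hasPn=> _ /mapP[j _ ->]; apply/mapP=> -[i _ /eqP]; rewrite eq_rlshift.
rewrite El scaler_eq0 negb_or; apply/andP; split.
  by rewrite prodr_enum; apply/prodf_neq0 => i _; apply: neq0Ci.
apply/eqP=> /(congr1 ( *%R ((-1) ^+ k))); rewrite signrMK mulr0 => /eqP.
rewrite scaler_eq0 signr_eq0 /= => /eqP/ffunP; set S := [set i in _]%SET.
by move/(_ S)/eqP; rewrite !ffunE eqxx oner_eq0.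
Qed.

(** After separating the (1,0) factors from the (0,1) factors, [prod_lin_comb]
    applies to A and to its conjugate, and the factor is D conj(D) with D the
    determinant of A.  It is nonzero: the dz_i are combinations of the coframe
    through the inverse of A, so D = 0 would make the volume form vanish. *)
Lemma prod_coframe11 A : A \in unitmx ->
  exists2 d : C, 0 < d &
    \prod_(i <- enum 'I_n) coframe11 A i = d *: volume_form R n.
Proof.
move=> Au; have [c Ec] := prod_lin_comb n.
(* the determinant, in the form that prod_lin_comb produces *)
pose D B := \sum_f (c f)%:~R * \prod_i B i (f i) : C.
have Dconj B : D (map_mx Num.conj B) = (D B)^*.
  rewrite rmorph_sum; apply: eq_bigr => f _.
  rewrite rmorphM rmorph_int rmorph_prod; congr (_ * _).
  by apply: eq_bigr => i _; rewrite mxE.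
have dz_anti i j : dz R i * dz R j = - (dz R j * dz R i) :> cform.
  have [u ->] := dz_lin i; have [v ->] := dz_lin j; exact: ext_lin_anticomm.
have dz_sqr i : dz R i * dz R i = 0 :> cform.
  by have [u ->] := dz_lin i; exact: ext_lin_sqr0.
have dzbar_anti i j : dzbar R i * dzbar R j = - (dzbar R j * dzbar R i) :> cform.
  have [u ->] := dzbar_lin i; have [v ->] := dzbar_lin j.
  exact: ext_lin_anticomm.
have dzbar_sqr i : dzbar R i * dzbar R i = 0 :> cform.
  by have [u ->] := dzbar_lin i; exact: ext_lin_sqr0.
have [k Ek] := prod_pairs (enum 'I_n).
have volE : volume_form R n = \prod_(i <- enum 'I_n) 'i%C *:
    ((-1) ^+ k * (\prod_i dz R i * \prod_i dzbar R i)) :> cform.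
  rewrite /volume_form -[\big[_/_]_(_ <- _) _]/(\prod_(j <- enum 'I_n)
    ('i%C *: (dz R j * dzbar R j : cform))) scaler_prod Ek ?prodr_enum //.
  move=> i j; have [u ->] := dz_lin i; have [v ->] := dzbar_lin j.
  exact: ext_lin_anticomm.
have prodA : \prod_i coframe A i = D A *: \prod_i dz R i.
  exact: Ec C cform _ A dz_anti dz_sqr.
have prod_barA : \prod_i coframe_bar A i = (D A)^* *: \prod_i dzbar R i.
  rewrite -Dconj -(Ec C cform _ (map_mx Num.conj A) dzbar_anti dzbar_sqr).
  apply: eq_bigr => i _; rewrite /coframe_bar /form01.
  by apply: eq_bigr => j _; rewrite mxE.
have D0 : D A != 0.
  apply: contraNneq volume_neq0 => DA0; rewrite volE.
  suff -> : \prod_i dz R i = 0 :> cform by rewrite mul0r mulr0 scaler0.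
  have -> : \prod_i dz R i = \prod_i \sum_j invmx A i j *: coframe A j :> cform.
    apply: eq_bigr => i _; rewrite /coframe /form10.
    under eq_bigr => j _ do rewrite scaler_sumr.
    rewrite exchange_big /=.
    under eq_bigr => j _.
      under eq_bigr do rewrite scalerA.
      rewrite -scaler_suml (_ : \sum_k _ = (invmx A *m A) i j); last by rewrite mxE.
      rewrite mulVmx // mxE; over.
    rewrite (bigD1 i) //= eqxx scale1r big1 ?addr0 // => j /negPf ji.
    by rewrite eq_sym ji scale0r.
  rewrite (Ec _ _ (coframe A)) => [|i j|i].
  - by rewrite prodA DA0 scale0r scaler0.
  - by have [u ->] := coframe_lin A i; have [v ->] := coframe_lin A j;
      exact: ext_lin_anticomm.
  - by have [u ->] := coframe_lin A i; exact: ext_lin_sqr0.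
exists (D A * (D A)^*); first by rewrite mul_conjC_gt0.
rewrite /coframe11 scaler_prod Ek; last first.
  move=> i j; have [u ->] := coframe_lin A i.
  by have [v ->] := coframe_bar_lin A j; exact: ext_lin_anticomm.
rewrite !prodr_enum prodA prod_barA volE.
rewrite -scalerAl -!scalerAr !scalerA; congr (_ *: _).
by rewrite prodr_enum mulrC.
Qed.

End Coframe.

(** * Positive forms in a common coframe *)

Section PositiveForms.
Variables (R : realType) (n : nat).
Local Notation C := R[i].
Local Notation cform := (ext C (n + n)).
Implicit Types (a b o : cform) (A : 'M[C]_n) (J : {set 'I_n}).

Lemma coframe11E A i : coframe11 A i =
  \sum_j \sum_k ('i%C * (A i j * (A i k)^*)) *: (dz R j * dzbar R k) :> cform.
Proof.
rewrite /coframe11 /coframe /coframe_bar /form10 /form01 mulr_suml scaler_sumr.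
apply: eq_bigr => j _; rewrite mulr_sumr scaler_sumr; apply: eq_bigr => k _.
by rewrite -scalerAl -scalerAr !scalerA mulrA.
Qed.

Lemma common_coframe a b : positive_definite11 a -> positive_definite11 b ->
  exists A (l : 'I_n -> C),
    [/\ A \in unitmx, forall i, 0 < l i,
        a = \sum_i coframe11 A i & b = \sum_i l i *: coframe11 A i].
Proof.
case=> G [Gherm Gpos ->] [H [Hherm Hpos ->]].
have [A [l [Au l0 GE HE]]] :=
  simultaneous_diag (conj Gherm Gpos) (conj Hherm Hpos).
exists A, l; split=> //.
- under [RHS]eq_bigr => i _ do rewrite coframe11E.
  rewrite [RHS]exchange_big; apply: eq_bigr => j _ /=.
  rewrite [RHS]exchange_big; apply: eq_bigr => k _ /=.
  by rewrite -scaler_suml GE mulr_sumr.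
under [RHS]eq_bigr => i _ do rewrite coframe11E scaler_sumr.
rewrite [RHS]exchange_big; apply: eq_bigr => j _ /=.
under [RHS]eq_bigr => i _ do rewrite scaler_sumr.
rewrite [RHS]exchange_big; apply: eq_bigr => k _ /=.
under [RHS]eq_bigr => i _ do rewrite scalerA mulrCA.
by rewrite -scaler_suml HE mulr_sumr.
Qed.

Lemma prod_tnth_cast (E : nzRingType) (I : Type) (s : seq I) (q : nat)
    (eq_q : q = size s) (F : I -> E) :
  \prod_(k <- enum 'I_q) F (tnth (in_tuple s) (cast_ord eq_q k)) =
  \prod_(j <- s) F j.
Proof.
subst q; rewrite prodr_enum [RHS]big_tnth.
by apply: eq_bigr => k _; rewrite cast_ord_id.
Qed.

(** The test forms of weak positivity are the theta_j with j in J, listed in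
    increasing order. *)
Lemma weakly_positive_mono q o A J : weakly_positive q o -> #|J| = (n - q)%N ->
  exists2 c : C, 0 <= c & o * mono (coframe11 A) J = c *: volume_form R n.
Proof.
rewrite cardE => pos /esym cJ; pose s := in_tuple (enum J).
have [k|c c0 Ec] := pos (fun k => coframe A (tnth s (cast_ord cJ k))).
  exact: bidegree_form10.
exists c => //; rewrite -Ec; congr (_ * _); rewrite /mono -(prod_tnth_cast cJ).
apply: eq_bigr => k _; rewrite /coframe11; congr (_ *: (_ * _)).
by rewrite [RHS]conj_form10.
Qed.

End PositiveForms.

Lemma quotient_formE (R : realType) (n : nat) (X : complexManifold R n)
    (v w : diff_form X) (x : X) (c : R[i]) :
  w x != 0 -> v x = c *: w x -> quotient_form v w x = c.
Proof.
move=> w0 vE; apply: xget_unique => //= c' vE'.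
apply/eqP; rewrite -subr_eq0; have : (c' - c) *: w x == 0.
  by rewrite scalerBl -vE -vE' subrr.
by rewrite scaler_eq0 (negPf w0) orbF.
Qed.

(** * The pointwise inequalities *)

Lemma mono_central (K : comNzRingType) (E : algType K) (I : finType)
    (w : I -> E) (J : {set I}) (a : E) :
  (forall i, w i * a = a * w i) -> mono w J * a = a * mono w J.
Proof. by move=> wa; apply/esym/commr_prod => i _; apply/esym/wa. Qed.

Lemma sum_mul_le (C : numDomainType) (I : finType) (P : pred I) (x y : I -> C) :
  (forall i, P i -> 0 <= x i) -> (forall i, P i -> 0 <= y i) ->
  \sum_(i | P i) x i * y i <= (\sum_(i | P i) x i) * \sum_(i | P i) y i.
Proof.
move=> x0 y0; rewrite mulr_suml; apply: ler_sum => i Pi.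
apply: ler_wpM2l; first exact: x0.
by rewrite (bigD1 i) //= lerDl sumr_ge0 // => j /andP[/y0].
Qed.

Theorem lemma7p1 (R : realType) (n : nat) (X : complexManifold R n)
    (α β : diff_form X) (hα : hermitian_metric α) (hβ : hermitian_metric β)
    (p : nat) (hp : (1 <= p <= n)%N)
    (Ω : diff_form X) (hΩ : positive_form (n - p) Ω) :
  forall x : X,
    (β ^\w p \w Ω ÷ α ^\w n)%form x <=
      'C(n, p)%:R * (α ^\w (n - p) \w β ^\w p ÷ α ^\w n)%form x
        * (α ^\w p \w Ω ÷ α ^\w n)%form x
    /\
    (α ^\w (p - 1) \w β \w Ω ÷ α ^\w n)%form x <=
      n%:R / p%:R * (α ^\w (n - 1) \w β ÷ α ^\w n)%form x
        * (α ^\w p \w Ω ÷ α ^\w n)%form x.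
Proof.
move=> x; case/andP: hp => p_gt0 le_pn.
have n_gt0 := leq_trans p_gt0 le_pn.
have [A [l [Au l0 aE bE]]] := common_coframe (hα.2 x) (hβ.2 x).
have [D D0 topE] := prod_coframe11 Au.
have [_ _ /(_ x) o_pos] := hΩ.
set w := coframe11 A in aE bE topE.
set a := α x in aE; set b := β x in bE; set o := Ω x in o_pos.
set vol := volume_form R n in topE.
have wZ i y : w i * y = y * w i by apply: coframe11_central.
have wC i j : w i * w j = w j * w i by apply: wZ.
have w0 i : w i * w i = 0 by apply: coframe11_sqr0.
have /fin_all_exists[c Ec] : forall J : {set 'I_n}, exists cJ : R[i],
    #|J| = p -> 0 <= cJ /\ o * mono w J = cJ *: vol.
  move=> J; have [cJ|ncJ] := eqVneq #|J| p; last first.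
    by exists 0 => cJ; rewrite cJ eqxx in ncJ.
  have [|c c0 cE] := weakly_positive_mono A o_pos (J := J); last by exists c.
  by rewrite subKn.
have mono_top : mono w [set: 'I_n]%SET = D *: vol.
  by rewrite -topE /mono enum_setT enumT.
(* Weak positivity multiplies Omega by w_J on the right, the quotients multiply
   it on the left; the monomial is central. *)
have mul_comb mu : (forall J : {set 'I_n}, #|J| != p -> mu J = 0) ->
    mono_comb w mu * o = (\sum_(J : {set 'I_n} | #|J| == p) mu J * c J) *: vol.
  move=> mu0; rewrite /mono_comb mulr_suml.
  rewrite (bigID (fun J : {set 'I_n} => #|J| == p)) /=.
  rewrite [X in _ + X]big1 ?addr0 => [|J /mu0 ->]; last by rewrite scale0r mul0r.
  rewrite scaler_suml; apply: eq_bigr => J /eqP cJ.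
  by rewrite -scalerAl mono_central // (Ec J cJ).2 scalerA.
have aX k : a ^+ k = mono_comb w (fun J : {set 'I_n} => ((#|J| == k) * k`!)%N%:R).
  by rewrite aE exp_mono_comb1.
have aN : a ^+ n = (n`!%:R * D) *: vol.
  rewrite aX mono_comb_full => [|J]; last first.
    by rewrite card_ord => /negPf ->; rewrite mul0n.
  by rewrite cardsT card_ord eqxx mul1n mono_top scalerA.
have N0 : 0 < n`!%:R * D by rewrite mulr_gt0 // ltr0n fact_gt0.
have aN0 : a ^+ n != 0.
  by rewrite aN scaler_eq0 negb_or gt_eqF // volume_neq0.
have quotE (v : diff_form X) e : v x = e *: vol ->
    (v ÷ α ^\w n)%form x = e / (n`!%:R * D).
  move=> vE; apply: quotient_formE; rewrite /wedgef_exp wedge_expE //.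
  by rewrite -/a aN scalerA divfK // gt_eqF.
have ba y : b * y = y * b.
  rewrite bE mulr_suml mulr_sumr; apply: eq_bigr => i _.
  by rewrite -scalerAl -scalerAr wZ.
pose s := \sum_(J : {set 'I_n} | #|J| == p) c J.
pose lprod (J : {set 'I_n}) := \prod_(i in J) l i.
pose lsum (J : {set 'I_n}) := \sum_(i in J) l i.
have q_aO : (α ^\w p \w Ω ÷ α ^\w n)%form x = p`!%:R * s / (n`!%:R * D).
  apply: quotE; rewrite /wedgef /wedgef_exp wedge_expE -[wedge _ _]/(a ^+ p * o).
  rewrite aX mul_comb => [|J /negPf ->]; last by rewrite mul0n.
  by congr (_ *: _); rewrite mulr_sumr; apply: eq_bigr => J ->; rewrite mul1n.
have q_bO : (β ^\w p \w Ω ÷ α ^\w n)%form x =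
    p`!%:R * (\sum_(J : {set 'I_n} | #|J| == p) lprod J * c J) / (n`!%:R * D).
  apply: quotE; rewrite /wedgef /wedgef_exp wedge_expE -[wedge _ _]/(b ^+ p * o).
  rewrite bE exp_mono_comb // mul_comb => [|J /negPf ->]; last first.
    by rewrite mul0n mul0r.
  congr (_ *: _); rewrite mulr_sumr; apply: eq_bigr => J ->.
  by rewrite mul1n mulrA.
have q_abO : (α ^\w (p - 1) \w β \w Ω ÷ α ^\w n)%form x =
    (p - 1)`!%:R * (\sum_(J : {set 'I_n} | #|J| == p) lsum J * c J)
      / (n`!%:R * D).
  apply: quotE; rewrite /wedgef /wedgef_exp wedge_expE.
  rewrite -[wedge _ _]/(a ^+ (p - 1) * b * o) -ba aE bE mul_exp_mono_comb //.
  rewrite subn1 prednK // mul_comb => [|J /negPf ->]; last first.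
    by rewrite mul0n mul0r.
  congr (_ *: _); rewrite mulr_sumr; apply: eq_bigr => J ->.
  by rewrite mul1n mulrA.
have q_ab : (α ^\w (n - 1) \w β ÷ α ^\w n)%form x =
    (n - 1)`!%:R * lsum [set: 'I_n]%SET * D / (n`!%:R * D).
  apply: quotE; rewrite /wedgef /wedgef_exp wedge_expE.
  rewrite -[wedge _ _]/(a ^+ (n - 1) * b) -ba aE bE mul_exp_mono_comb //.
  rewrite subn1 prednK // mono_comb_full => [|J]; last first.
    by rewrite card_ord => /negPf ->; rewrite mul0n mul0r.
  by rewrite cardsT card_ord eqxx mul1n mono_top scalerA.
have q_abX : (α ^\w (n - p) \w β ^\w p ÷ α ^\w n)%form x =
    ((n - p)`! * p`!)%:R * (\sum_(J : {set 'I_n} | #|J| == p) lprod J) * D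
      / (n`!%:R * D).
  apply: quotE; rewrite /wedgef /wedgef_exp !wedge_expE.
  rewrite -[wedge _ _]/(a ^+ (n - p) * b ^+ p) aE bE.
  have le_pI : (p <= #|'I_n|)%N by rewrite card_ord.
  have E := exp_mul_exp wC w0 l le_pI; rewrite card_ord in E.
  by rewrite E mono_top; exact: scalerA.
have D_neq0 : D != 0 by rewrite gt_eqF.
have fact_neq0 k : k`!%:R != 0 :> R[i] by rewrite pnatr_eq0 -lt0n fact_gt0.
have c0 (J : {set 'I_n}) : #|J| == p -> 0 <= c J by move=> /eqP/Ec[].
rewrite {}q_aO {}q_bO {}q_abO {}q_ab {}q_abX; split.
  set L := \sum_(J : {set 'I_n} | _) lprod J.
  have -> : 'C(n, p)%:R * (((n - p)`! * p`!)%:R * L * D / (n`!%:R * D)) = L.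
    rewrite -!mulrA mulrA -natrM [(_`! * _)%N]mulnC bin_fact //.
    by rewrite mulrCA [X in _ * X]mulrA mulfV ?mulr1 // mulf_neq0.
  rewrite [leRHS]mulrA (mulrCA L) ler_pM2r ?invr_gt0 //.
  rewrite ler_pM2l ?ltr0n ?fact_gt0 //; apply: sum_mul_le => // J _.
  by apply: prodr_ge0 => i _; apply: ltW.
set L := lsum [set: 'I_n]%SET.
have -> : n%:R / p%:R * ((n - 1)`!%:R * L * D / (n`!%:R * D)) = L / p%:R.
  rewrite -[in n`!](prednK n_gt0) factS prednK // subn1 natrM.
  have n0 : n%:R != 0 :> R[i] by rewrite pnatr_eq0 -lt0n.
  have := fact_neq0 n.-1; move: (n.-1`!%:R) => f f0.
  have p0 : p%:R != 0 :> R[i] by rewrite pnatr_eq0 -lt0n.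
  by field; rewrite D_neq0 f0 n0 p0.
have -> : p`!%:R = p%:R * (p - 1)`!%:R :> R[i].
  by rewrite subn1 -natrM -{2}(prednK p_gt0) -factS prednK.
have -> : L / p%:R * (p%:R * (p - 1)`!%:R * s / (n`!%:R * D)) =
    (p - 1)`!%:R * (L * s) / (n`!%:R * D).
  by rewrite !mulrA mulfVK ?pnatr_eq0 -?lt0n // (mulrC L).
rewrite ler_pM2r ?invr_gt0 // ler_pM2l ?ltr0n ?fact_gt0 // mulr_sumr.
apply: ler_sum => J cJ; apply: ler_wpM2r; first exact: c0.
(* the sum over J is part of the sum over all indices *)
rewrite /L /lsum [leRHS](bigID (fun i => i \in J)) /=.
rewrite [X in _ <= X + _](eq_bigl (fun i => i \in J)) => [|i]; last by rewrite inE.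
by rewrite lerDl; apply: sumr_ge0 => i _; apply: ltW.
Qed.
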